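(* Let $X$ be a locally compact sober space. Then: (1) the Scott power space of $X$ and the Smyth power space of $X$ coincide, that is, $\Sigma\,\mathsf{K}(X)=P_S(X)$; (2) $\mathsf{K}(X)$ is a continuous domain; (3) $\Sigma\,\mathsf{K}(X)$ is a sober $c$-space.
   Context: A subset of a $T_0$ space $X$ is saturated if it equals the intersection of all open sets containing it (equivalently, it is an upper set in the specialization order $x\le y \iff x\in\overline{\{y\}}$). $\mathsf{K}(X)$ denotes the set of all nonempty compact saturated subsets of $X$, ordered by the Smyth order $K_1\sqsubseteq K_2 \iff K_2\subseteq K_1$. The Smyth power space $P_S(X)$ is $\mathsf{K}(X)$ with the upper Vietoris topology, which has base $\{\Box U: U \text{ open in } X\}$, where $\Box U=\{K\in\mathsf{K}(X):K\subseteq U\}$. For a poset $P$, a subset $U$ is Scott open if $U$ is an upper set and for every (nonempty) directed $D\subseteq P$ whose supremum $\bigvee D$ exists in $P$, $\bigvee D\in U$ implies $D\cap U\neq\emptyset$; these sets form the Scott topology $\sigma(P)$, and $\Sigma P=(P,\sigma(P))$. The Scott power space of $X$ is $\Sigma\,\mathsf{K}(X)=(\mathsf{K}(X),\sigma(\mathsf{K}(X)))$. In a dcpo $P$, $u\ll x$ means that for every directed $D$ with $x\le\bigvee D$ there is $d\in D$ with $u\le d$; a dcpo $P$ is a continuous domain if for each $x\in P$ the set $\{u: u\ll x\}$ is directed with supremum $x$. A space $Y$ is a $c$-space if for each $y\in Y$ and each open neighborhood $U$ of $y$ there is $u\in Y$ with $y\in\mathrm{int}\,{\uparrow}u\subseteq{\uparrow}u\subseteq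 U$, where ${\uparrow}u$ is the upper set of $u$ in the specialization order. Locally compact: every neighborhood of every point contains a compact neighborhood of that point. Sober: every irreducible closed subset is the closure of a unique point. *)

(* Defs.v *)
From HB Require Import structures.
From mathcomp Require Import all_boot all_order all_classical.
From mathcomp Require Import topology.

Set Implicit Arguments.
Unset Strict Implicit.
Unset Printing Implicit Defensive.

Import Order.TTheory.
Local Open Scope classical_set_scope.
Local Open Scope order_scope.

Section DomainTheory.
Context {d : Order.disp_t} {P : porderType d}.
Implicit Types (D U : set P) (x u s : P).

Definition directed_set D :=
  D !=set0 /\
  forall a b, D a -> D b -> exists c, [/\ D c, a <= c & b <= c].

Definition scott_open U :=
  (forall a b, U a -> a <= b -> U b) /\
  (forall D s, directed_set D -> isLub D s -> U s -> D `&` U !=set0).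

Definition dcpo := forall D, directed_set D -> exists s, isLub D s.

Definition way_below u x :=
  forall D s, directed_set D -> isLub D s -> x <= s ->
    exists2 a, D a & u <= a.

Definition continuous_domain :=
  dcpo /\
  forall x, directed_set [set u | way_below u x] /\
            isLub [set u | way_below u x] x.

End DomainTheory.

Arguments dcpo {d} P.
Arguments continuous_domain {d} P.

Definition scott {d : Order.disp_t} (P : porderType d) : Type := P.

Section ScottTopology.
Context {d : Order.disp_t} (P : porderType d).

Local Lemma scott_openT : scott_open [set: P].
Proof. by split=> // D s [[a Da] _] _ _; exists a. Qed.

Local Lemma scott_openI : setI_closed (@scott_open d P).
Proof.
move=> U V [Uup Usc] [Vup Vsc]; split.
  by move=> a b [Ua Va] ab; split; [exact: Uup ab|exact: Vup ab].
move=> D s dD Ds [Us Vs].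
have [a [Da Ua]] := Usc _ _ dD Ds Us.
have [b [Db Vb]] := Vsc _ _ dD Ds Vs.
have [c [Dc ac bc]] := dD.2 _ _ Da Db.
by exists c; split=> //; split; [exact: Uup ac|exact: Vup bc].
Qed.

Local Lemma scott_open_bigU (I : Type) (f : I -> set P) :
  (forall i, scott_open (f i)) -> scott_open (\bigcup_i f i).
Proof.
move=> fop; split.
  by move=> a b [i _ fa] ab; exists i => //; exact: (fop i).1 ab.
move=> D s dD Ds [i _ fs]; have [a [Da fa]] := (fop i).2 _ _ dD Ds fs.
by exists a; split=> //; exists i.
Qed.

HB.instance Definition _ := Order.POrder.on (scott P).
HB.instance Definition _ := isOpenTopological.Build (scott P)
  scott_openT scott_openI scott_open_bigU.

Lemma scott_openE : @open (scott P) = @scott_open d P.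
Proof. by []. Qed.

End ScottTopology.

Section Spaces.
Context {T : topologicalType}.
Implicit Types (A : set T) (x y : T).

Definition specialization x y := closure [set y] x.

Definition saturated A :=
  A = \bigcap_(U in [set U | open U /\ A `<=` U]) U.

Definition irreducible A :=
  A !=set0 /\
  forall B C, closed B -> closed C -> A `<=` B `|` C -> A `<=` B \/ A `<=` C.

End Spaces.

(* The library's [locally_compact] asks for closed compact neighbourhoods,
   which is too strong for spaces that are not Hausdorff. *)
Definition locally_compact_space (T : topologicalType) :=
  forall (x : T) (N : set T), nbhs x N ->
    exists C : set T, [/\ nbhs x C, compact C & C `<=` N].

Definition sober (T : topologicalType) :=
  forall A : set T, closed A -> irreducible A ->
    exists! x : T, A = closure [set x].

Definition c_space (T : topologicalType) :=
  forall (y : T) (U : set T), open U -> U y ->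
    exists u : T, interior [set z | specialization u z] y /\
                  [set z | specialization u z] `<=` U.

Definition compact_saturated {X : topologicalType} : set (set X) :=
  [set K | [/\ K !=set0, compact K & saturated K]].

Definition Kset (X : topologicalType) : Type :=
  set_type (@compact_saturated X).

Definition Kval {X : topologicalType} (K : Kset X) : set X := val K.

Fact smyth_display : Order.disp_t. Proof. exact: Order.Disp tt tt. Qed.

Section SmythOrder.
Context (X : topologicalType).

HB.instance Definition _ := Choice.on (Kset X).

Definition smyth_le (K1 K2 : Kset X) : bool := `[< Kval K2 `<=` Kval K1 >].

Local Lemma smyth_le_refl : reflexive smyth_le.
Proof. by move=> K; apply/asboolP. Qed.

Local Lemma smyth_le_anti : antisymmetric smyth_le.
Proof.
move=> K1 K2 /andP[/asboolP K21 /asboolP K12].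
by apply/val_inj/seteqP; split.
Qed.

Local Lemma smyth_le_trans : transitive smyth_le.
Proof.
move=> K2 K1 K3 /asboolP K21 /asboolP K32; apply/asboolP.
exact: subset_trans K32 K21.
Qed.

HB.instance Definition _ := Order.Le_isPOrder.Build smyth_display (Kset X)
  smyth_le_refl smyth_le_anti smyth_le_trans.

Lemma Kset_leP (K1 K2 : Kset X) :
  reflect (Kval K2 `<=` Kval K1) (K1 <= K2).
Proof. exact: asboolP. Qed.

End SmythOrder.

Definition smyth_power (X : topologicalType) : Type := Kset X.

Section UpperVietoris.
Context (X : topologicalType).

Definition box (U : set X) : set (Kset X) := [set K | Kval K `<=` U].

Local Lemma box_cover : \bigcup_(U in @open X) box U = setT.
Proof. by apply/seteqP; split=> // K _; exists setT => //; exact: openT. Qed.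

Local Lemma box_join (U V : set X) (K : Kset X) :
  open U -> open V -> box U K -> box V K ->
  exists W, [/\ open W, box W K & box W `<=` box U `&` box V].
Proof.
move=> oU oV KU KV; exists (U `&` V); split; first exact: openI.
  by move=> x Kx; split; [exact: KU|exact: KV].
by move=> L LUV; split=> x /LUV[].
Qed.

HB.instance Definition _ := Choice.on (smyth_power X).
HB.instance Definition _ := @isBaseTopological.Build (smyth_power X)
  (set X) (@open X) box box_cover box_join.

Lemma smyth_power_openE : @open (smyth_power X) =
  [set \bigcup_(U in B) box U | B in [set B | B `<=` @open X]].
Proof. by []. Qed.

End UpperVietoris.

(* Main.v *)
Require Import Defs.
From mathcomp Require Import all_boot all_order all_classical.
From mathcomp Require Import topology.

Set Implicit Arguments.
Unset Strict Implicit.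

Import Order.TTheory.

Local Open Scope classical_set_scope.

(** Everything rests on two facts about compact saturated sets.

    - Well-filteredness (from sobriety): if a filtered family of compact
      saturated sets has its intersection inside an open set [U], then some
      member already lies in [U] ([sober_well_filtered]).  Hence the supremum
      of a directed family for the Smyth order is its intersection, and
      [K(X)] is a dcpo in which every [box U] is Scott open.
    - Interpolation (from local compactness): between a compact set and an open
      set containing it fits a compact saturated set whose interior contains the
      compact one ([compact_open_interpolation]).  Hence every [K] in [K(X)] is
      the directed supremum of those [Q] whose interior contains [K].

    Together they give [Q << K] iff [K] is included in the interior of [Q], so
    [K(X)] is a continuous domain.  They also identify the two topologies: a
    Scott open set containing [K] contains some [Q] with [K] inside the interior
    of [Q], and then it contains the whole of [box] of that interior.  Finally,
    the Scott topology of any continuous domain is that of a sober c-space: the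
    sets of points way above a given point form a base, and the supremum of the
    points way below a member of an irreducible closed set generates it. *)

(** * Compactness, directed covers and saturation *)

(** Compactness is used below in this form: a directed open cover has a single
    member that covers.  It stands in for the choice of a finite subcover. *)
Definition up_directed {T : Type} (F : set (set T)) :=
  F !=set0 /\
  forall U V, F U -> F V -> exists W, [/\ F W, U `<=` W & V `<=` W].

(** If no member of the family contained [A], the traces on [A] of the
    complements would generate a proper filter, and a cluster point of it could
    lie in no member. *)
Lemma compact_directed_cover {T : topologicalType} (A : set T)
    (F : set (set T)) :
  compact A -> up_directed F -> F `<=` open -> A `<=` \bigcup_(U in F) U ->
  exists2 U, F U & A `<=` U.
Proof.
move=> cA [[U0 FU0] dF] oF AF; apply: contrapT => nF.
have fF : ProperFilter (filter_from F (fun U => A `\` U)).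
  apply: filter_from_proper.
    apply: filter_from_filter; first by exists U0.
    move=> U V FU FV; have [W [FW UW VW]] := dF _ _ FU FV.
    by exists W => // x [Ax Wx]; split; split=> // ?; apply: Wx; auto.
  move=> U FU; apply: contrapT => AU; apply: nF; exists U => // x Ax.
  by apply: contrapT => Ux; apply: AU; exists x.
have [|x [Ax clx]] := cA _ fF.
  by exists U0 => // x [].
have [U FU Ux] := AF _ Ax.
have [||y [[_ ny] //]] := clx (A `\` U) U.
  by exists U.
by apply: open_nbhs_nbhs; split=> //; exact: oF.
Qed.

(** Conversely, the opens disjoint from some member of a filter form a directed
    family, which covers [A] as soon as the filter has no cluster point in
    [A]. *)
Lemma directed_cover_compact {T : topologicalType} (A : set T) :
  (forall F : set (set T), up_directed F -> F `<=` open ->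
     A `<=` \bigcup_(U in F) U -> exists2 U, F U & A `<=` U) ->
  compact A.
Proof.
move=> cA F FF FA; apply: contrapT => nF.
have [| | |U [oU FU] AU] := cA [set U | open U /\ F (~` U)].
- split; first by exists set0; split; [exact: open0|rewrite setC0; exact: filterT].
  move=> U V [oU FU] [oV FV]; exists (U `|` V); split.
  + by split; [exact: openU|rewrite setCU; exact: filterI].
  + by move=> x; left.
  + by move=> x; right.
- by move=> U [].
- move=> x Ax; apply: contrapT => nx; apply: nF; exists x; split=> //.
  move=> B V FB; rewrite nbhsE => -[W [oW Wx] WV]; apply: contrapT => BV.
  apply: nx; exists W => //; split=> //; apply: filterS FB => y By Wy.
  by apply: BV; exists y; split=> //; exact: WV.
- have [x [Ax nUx]] := filter_ex (filterI FA FU).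
  exact: nUx (AU _ Ax).
Qed.

(** The least saturated superset, which makes a member of [K(X)] out of any
    nonempty compact set. *)
Definition saturation {T : topologicalType} (A : set T) : set T :=
  \bigcap_(U in [set U | open U /\ A `<=` U]) U.

Lemma subset_saturation {T : topologicalType} (A : set T) :
  A `<=` saturation A.
Proof. by move=> x Ax U [_]; exact. Qed.

Lemma saturation_sub_open {T : topologicalType} (A U : set T) :
  open U -> A `<=` U -> saturation A `<=` U.
Proof. by move=> oU AU x; apply. Qed.

Lemma saturated_saturation {T : topologicalType} (A : set T) :
  saturated (saturation A).
Proof.
apply/seteqP; split; first exact: subset_saturation.
move=> x sx U [oU AU]; apply: sx; split=> //.
exact: saturation_sub_open.
Qed.

(** A set and its saturation have the same open neighbourhoods. *)
Lemma compact_saturation {T : topologicalType} (A : set T) :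
  compact A -> compact (saturation A).
Proof.
move=> cA; apply: directed_cover_compact => F dF oF AF.
have [|U FU AU] := compact_directed_cover cA dF oF.
  exact: subset_trans (@subset_saturation _ A) AF.
by exists U => //; apply: saturation_sub_open => //; exact: oF.
Qed.

Lemma saturated_specialization {T : topologicalType} (A : set T) (x y : T) :
  saturated A -> specialization x y -> A x -> A y.
Proof.
move=> sA xy; rewrite sA => Ax U AU.
have [|z [-> //]] := xy U.
by apply: open_nbhs_nbhs; split; [exact: AU.1|exact: Ax].
Qed.

(** The compact subsets of [U] have a directed family of interiors, which
    covers [U] by local compactness. *)
Lemma compact_open_interpolation {X : topologicalType} (A U : set X) :
  locally_compact_space X -> compact A -> open U -> A `<=` U ->
  exists Q, [/\ compact Q, saturated Q, A `<=` interior Q & Q `<=` U].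
Proof.
move=> hlc cA oU AU.
pose F := [set interior C | C in [set C : set X | compact C /\ C `<=` U]].
have [| | |V [C [cC CU] <-] AC] := @compact_directed_cover _ A F cA.
- split.
    exists (interior set0), set0 => //.
    by split; [exact: compact0|exact: sub0set].
  move=> _ _ [C [cC CU] <-] [D [cD DU] <-].
  exists (interior (C `|` D)); split.
  + exists (C `|` D) => //; split; first exact: compactU.
    by move=> x [/CU|/DU].
  + by apply: interiorS => x; left.
  + by apply: interiorS => x; right.
- by move=> _ [C _ <-]; exact: open_interior.
- move=> x /AU Ux; have [|C [Cx cC CU]] := hlc x U.
    by apply: open_nbhs_nbhs.
  by exists (interior C) => //; exists C.
exists (saturation C); split.
- exact: compact_saturation.
- exact: saturated_saturation.
- by apply: subset_trans AC _; apply: interiorS; exact: subset_saturation.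
- exact: saturation_sub_open.
Qed.

(** * Well-filteredness of sober spaces and directed suprema in K(X) *)

Lemma Kset_compact_saturated {X : topologicalType} (K : Kset X) :
  compact_saturated (Kval K).
Proof. exact: set_valP. Qed.

(** Take a maximal open [M] containing [U] and no member of [D]: compactness of
    the members makes Zorn's lemma applicable.  Maximality makes [~` M]
    irreducible, hence the closure of a point [c].  Each member of [D] meets
    [~` M], so contains [c] because it is saturated; thus [c] lies in the
    intersection of [D] but not in [U]. *)
Lemma sober_well_filtered {X : topologicalType} (D : set (Kset X))
    (U : set X) :
  sober X -> directed_set D -> open U -> \bigcap_(K in D) Kval K `<=` U ->
  exists2 K, D K & Kval K `<=` U.
Proof.
move=> hs [[K0 DK0] dD] oU DU; apply: contrapT => nD.
(* Zorn's lemma also speaks of the empty chain, whose union is empty: the sets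
   [W] are therefore only required to avoid [D] after adjoining [U]. *)
pose P := [set W : set X |
  open (U `|` W) /\ forall K, D K -> ~ Kval K `<=` U `|` W].
have [|A [[oM DM] maxM]] := @Zorn_bigcup _ P.
  move=> F FP totF.
  pose G := [set V | V = U \/ exists2 W, F W & V = U `|` W].
  have GE : U `|` \bigcup_(W in F) W = \bigcup_(V in G) V.
    apply/seteqP; split=> x.
      case=> [Ux|[W FW Wx]]; first by exists U => //; left.
      by exists (U `|` W); right=> //; exists W.
    case=> V [->|[W FW ->]]; first by left.
    by case=> [|Wx]; [left|right; exists W].
  have oG : G `<=` open by move=> V [->//|[W FW ->]]; exact: (FP _ FW).1.
  split; first by rewrite GE; apply: bigcup_open => V; exact: oG.
  rewrite GE => K DK KG.
  have [_ cK _] := Kset_compact_saturated K.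
  have [|V [->|[W FW ->]] KV] := compact_directed_cover cK _ oG KG.
  - split; first by exists U; left.
    move=> V1 V2 [->|[W1 F1 ->]] [->|[W2 F2 ->]].
    + by exists U; split=> //; left.
    + by exists (U `|` W2); split=> //; right; exists W2.
    + by exists (U `|` W1); split=> //; right; exists W1.
    + have [/(@setUS _ U) W12|/(@setUS _ U) W21] := totF _ _ F1 F2.
      * by exists (U `|` W2); split=> //; right; exists W2.
      * by exists (U `|` W1); split=> //; right; exists W1.
  - by apply: nD; exists K.
  - exact: (FP _ FW).2 KV.
set M := U `|` A in oM DM.
have max B : closed B -> ~ (~` M `<=` B) ->
    exists2 K, D K & Kval K `<=` M `|` ~` B.
  move=> cB nMB; apply: contrapT => nK.
  have UE : U `|` (M `|` ~` B) = M `|` ~` B by rewrite /M !setUA setUid.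
  apply: (maxM (M `|` ~` B)); last first.
    split; rewrite UE; first by apply: openU => //; exact: closed_openC.
    by move=> K DK KB; apply: nK; exists K.
  split; first by move=> x Ax; left; right.
  move=> MBA; apply: nMB => x nMx; apply: contrapT => nBx.
  by apply: nMx; right; apply: MBA; right.
have irrM : irreducible (~` M).
  split.
    apply: contrapT => nM; apply: (DM _ DK0) => x _.
    by apply: contrapT => nMx; apply: nM; exists x.
  move=> B C cB cC MBC; apply: contrapT => /not_orP[nB nC].
  have [K1 DK1 K1B] := max B cB nB.
  have [K2 DK2 K2C] := max C cC nC.
  have [K3 [DK3 /Kset_leP K31 /Kset_leP K32]] := dD _ _ DK1 DK2.
  apply: (DM _ DK3) => x K3x; apply: contrapT => nMx.
  have [//|nBx] := K1B _ (K31 _ K3x).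
  have [//|nCx] := K2C _ (K32 _ K3x).
  by case: (MBC x nMx).
have [c [Mc _]] := hs _ (open_closedC oM) irrM.
have nMc : ~ M c.
  have : (~` M) c by rewrite Mc; exact: subset_closure.
  by [].
apply: nMc; left; apply: DU => K DK.
have [_ _ sK] := Kset_compact_saturated K.
have [x [Kx nMx]] : exists x, Kval K x /\ (~` M) x.
  apply: contrapT => nx; apply: (DM _ DK) => x Kx.
  by apply: contrapT => nMx; apply: nx; exists x.
by apply: saturated_specialization sK _ Kx; rewrite /specialization -Mc.
Qed.

(** Nonemptiness and compactness are well-filteredness applied to the empty set
    and to the union of a directed open cover of the intersection. *)
Lemma directed_Kset_bigcap {X : topologicalType} (D : set (Kset X)) :
  sober X -> directed_set D -> compact_saturated (\bigcap_(K in D) Kval K).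
Proof.
move=> hs dD; split.
- apply: contrapT => D0.
  have [|K DK K0] := sober_well_filtered hs dD open0.
    by move=> x Dx; apply: D0; exists x.
  have [[x Kx] _ _] := Kset_compact_saturated K.
  exact: K0 Kx.
- apply: directed_cover_compact => F [F0 dF] oF DF.
  have [|K DK KF] := sober_well_filtered hs dD _ DF.
    exact: bigcup_open.
  have [_ cK _] := Kset_compact_saturated K.
  have [V FV KV] := compact_directed_cover cK (conj F0 dF) oF KF.
  by exists V => // x Dx; apply: KV; exact: Dx.
- apply/seteqP; split; first exact: subset_saturation.
  move=> x Dx K DK.
  have [_ _ ->] := Kset_compact_saturated K.
  move=> V [oV KV]; apply: Dx; split=> // y Dy.
  by apply: KV; exact: Dy.
Qed.

Definition Kset_of {X : topologicalType} (A : set X)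
  (cA : compact_saturated A) : Kset X := SigSub (mem_set cA).

Lemma isLub_bigcap {X : topologicalType} (D : set (Kset X)) (K : Kset X) :
  Kval K = \bigcap_(L in D) Kval L -> isLub D K.
Proof.
move=> KE; split.
  by move=> L DL; apply/Kset_leP; rewrite KE => x; apply.
move=> L ubL; apply/Kset_leP => x Lx; rewrite KE => Q DQ.
exact: (elimT (Kset_leP _ _) (ubL Q DQ)).
Qed.

Lemma isLub_unique {d : Order.disp_t} {P : porderType d} (D : set P)
  (s t : P) : isLub D s -> isLub D t -> s = t.
Proof.
by move=> [us ls] [ut lt]; apply: le_anti; rewrite ls// lt.
Qed.

Lemma Kset_lub {X : topologicalType} (D : set (Kset X)) :
  sober X -> directed_set D ->
  exists2 K, isLub D K & Kval K = \bigcap_(L in D) Kval L.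
Proof.
move=> hs dD; exists (Kset_of (directed_Kset_bigcap hs dD)) => //.
exact: isLub_bigcap.
Qed.

(** Well-filteredness restated for abstract suprema, as the definitions of Scott
    open sets and of the way-below relation require. *)
Lemma directed_lub_sub_open {X : topologicalType} (D : set (Kset X))
    (K : Kset X) (U : set X) :
  sober X -> directed_set D -> isLub D K -> open U -> Kval K `<=` U ->
  exists2 L, D L & Kval L `<=` U.
Proof.
move=> hs dD DK oU KU; apply: sober_well_filtered => //.
have [L DL LE] := Kset_lub hs dD.
by rewrite -LE (isLub_unique DL DK).
Qed.

(** * Approximation in K(X) over a locally compact space *)

Lemma Kset_interpolation {X : topologicalType} (K : Kset X) (U : set X) :
  locally_compact_space X -> open U -> Kval K `<=` U ->
  exists2 Q : Kset X, Kval K `<=` interior (Kval Q) & Kval Q `<=` U.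
Proof.
move=> hlc oU KU; have [[x Kx] cK _] := Kset_compact_saturated K.
have [Q [cQ sQ KQ QU]] := compact_open_interpolation hlc cK oU KU.
have csQ : compact_saturated Q.
  by split=> //; exists x; apply: interior_subset; exact: KQ.
by exists (Kset_of csQ).
Qed.

(** The explicit description of the elements way below [K]; that it is one is
    [Kset_way_belowE]. *)
Definition interior_approx {X : topologicalType} (K : Kset X) :
  set (Kset X) := [set Q | Kval K `<=` interior (Kval Q)].

(** An upper bound of [Q1] and [Q2] is interpolated between [K] and the
    intersection of their interiors. *)
Lemma interior_approx_directed {X : topologicalType} (K : Kset X) :
  locally_compact_space X -> directed_set (interior_approx K).
Proof.
move=> hlc; split.
  have [Q KQ _] := Kset_interpolation hlc openT (@subsetT _ (Kval K)).
  by exists Q.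
move=> Q1 Q2 KQ1 KQ2.
have [||Q KQ] := @Kset_interpolation _ K
  (interior (Kval Q1) `&` interior (Kval Q2)) hlc.
- by apply: openI; exact: open_interior.
- by move=> x Kx; split; [exact: KQ1|exact: KQ2].
- rewrite subsetI => -[Q1Q Q2Q]; exists Q; split=> //.
  + by apply/Kset_leP; apply: subset_trans Q1Q _; exact: interior_subset.
  + by apply/Kset_leP; apply: subset_trans Q2Q _; exact: interior_subset.
Qed.

(** [K] is saturated, hence the intersection of its open neighbourhoods, and
    interpolation puts some approximant inside each of them. *)
Lemma interior_approx_lub {X : topologicalType} (K : Kset X) :
  locally_compact_space X -> isLub (interior_approx K) K.
Proof.
move=> hlc; apply: isLub_bigcap; apply/seteqP; split.
  by move=> x Kx Q KQ; apply: interior_subset; exact: KQ.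
move=> x Qx; have [_ _ ->] := Kset_compact_saturated K.
move=> U [oU KU]; have [Q KQ QU] := Kset_interpolation hlc oU KU.
by apply: QU; exact: Qx.
Qed.

(** If [Q << K], the relation is tested on the approximants of [K] themselves:
    one of them, [L], is contained in [Q], so [K] lies in the interior of [L] and
    then in that of [Q].  Conversely, the interior of [Q] is an open
    neighbourhood to which well-filteredness applies. *)
Lemma Kset_way_belowE {X : topologicalType} (K : Kset X) :
  locally_compact_space X -> sober X ->
  [set Q | way_below Q K] = interior_approx K.
Proof.
move=> hlc hs; apply/seteqP; split=> Q.
  move=> /(_ _ _ (interior_approx_directed K hlc) (interior_approx_lub K hlc)).
  case=> // L KL /Kset_leP LQ.
  exact: subset_trans KL (interiorS LQ).
move=> KQ D S dD DS /Kset_leP SK.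
have [||L DL LQ] := directed_lub_sub_open (U := interior (Kval Q)) hs dD DS.
- exact: open_interior.
- exact: subset_trans SK KQ.
- exists L => //; apply/Kset_leP; apply: subset_trans LQ _.
  exact: interior_subset.
Qed.

Lemma Kset_continuous_domain {X : topologicalType} :
  locally_compact_space X -> sober X -> continuous_domain (Kset X).
Proof.
move=> hlc hs; split.
  by move=> D dD; have [K DK _] := Kset_lub hs dD; exists K.
move=> K; rewrite Kset_way_belowE//; split.
  exact: interior_approx_directed.
exact: interior_approx_lub.
Qed.

(** * Comparison of the Scott and upper Vietoris topologies *)

Lemma box_scott_open {X : topologicalType} (U : set X) :
  sober X -> open U -> scott_open (box U).
Proof.
move=> hs oU; split.
  by move=> K L KU /Kset_leP LK; exact: subset_trans LK KU.
move=> D K dD DK KU; have [L DL LU] := directed_lub_sub_open hs dD DK oU KU.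
by exists L.
Qed.

(** A Scott open set containing [K] contains an approximant [Q] of [K], hence
    also the basic neighbourhood [box (interior Q)] of [K], all of whose elements
    are above [Q]. *)
Lemma scott_smyth_power_open {X : topologicalType} :
  locally_compact_space X -> sober X ->
  @open (scott (Kset X)) = @open (smyth_power X) :> set (set (Kset X)).
Proof.
move=> hlc hs; rewrite scott_openE smyth_power_openE.
apply/seteqP; split=> [S [upS lubS]|_ [B Bo <-]].
  exists [set U | open U /\ box U `<=` S]; first by move=> U [].
  apply/seteqP; split=> [K [U [_ US] KU]|K SK]; first exact: US.
  have [Q [KQ SQ]] := lubS _ _ (interior_approx_directed K hlc)
    (interior_approx_lub K hlc) SK.
  exists (interior (Kval Q)) => //; split; first exact: open_interior.
  move=> L LQ; apply: upS SQ _; apply/Kset_leP.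
  by apply: subset_trans LQ _; exact: interior_subset.
rewrite -scott_openE; apply: (@bigcup_open (scott (Kset X))) => U BU.
by rewrite scott_openE; apply: box_scott_open => //; exact: Bo.
Qed.

(** * The Scott topology of a continuous domain *)

Section ContinuousDomain.
Context {d : Order.disp_t} (P : porderType d).
Implicit Types (u x y z : P).

(** The principal ideal of [y] is Scott closed, so it is the closure of [y]. *)
Lemma scott_specializationE x y :
  @specialization (scott P) x y <-> (x <= y)%O.
Proof.
split=> [xy|xy U].
  apply: contrapT => nxy.
  have oC : @open (scott P) [set z | ~ (z <= y)%O].
    rewrite scott_openE; split.
      by move=> a b nay ab bay; apply: nay; exact: le_trans ab bay.
    move=> D s dD Ds nsy; apply: contrapT => nD; apply: nsy.
    apply: Ds.2 => a Da; apply: contrapT => nay; apply: nD.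
    by exists a.
  have [|z [->]] := xy [set z | ~ (z <= y)%O].
    exact: open_nbhs_nbhs.
  by apply; exact: lexx.
rewrite nbhsE => -[V [oV Vx] VU]; exists y; split=> //; apply: VU.
by move: oV; rewrite scott_openE => -[upV _]; exact: upV xy.
Qed.

Context (cP : continuous_domain P).

Let approx_directed x : directed_set [set u | way_below u x] := (cP.2 x).1.
Let approx_lub x : isLub [set u | way_below u x] x := (cP.2 x).2.

Lemma way_below_le u x : way_below u x -> (u <= x)%O.
Proof. exact: (approx_lub x).1. Qed.

Lemma way_below_trans_le u x y : way_below u x -> (x <= y)%O -> way_below u y.
Proof. by move=> ux xy D s dD Ds /(le_trans xy); exact: ux. Qed.

(** The elements that are two way-below steps under [x] already form a directed
    set with supremum [x], so [u << x] puts [u] below one of them. *)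
Lemma way_below_interpolation u x :
  way_below u x -> exists2 v, way_below u v & way_below v x.
Proof.
move=> ux; pose D := [set w | exists2 v, way_below w v & way_below v x].
have dD : directed_set D.
  split.
    have [[v vx] _] := approx_directed x.
    have [[w wv] _] := approx_directed v.
    by exists w, v.
  move=> w1 w2 [v1 wv1 vx1] [v2 wv2 vx2].
  have [v [vx v1v v2v]] := (approx_directed x).2 _ _ vx1 vx2.
  have [w [wv w1w w2w]] := (approx_directed v).2 _ _
    (way_below_trans_le wv1 v1v) (way_below_trans_le wv2 v2v).
  by exists w; split=> //; exists v.
have Dx : isLub D x.
  split=> [w [v wv vx]|b ub].
    exact: le_trans (way_below_le wv) (way_below_le vx).
  apply: (approx_lub x).2 => v vx; apply: (approx_lub v).2 => w wv.
  by apply: ub; exists v.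
have [w [v wv vx] uw] := ux _ _ dD Dx (lexx x).
exists v => // E s dE Es vs.
by have [a Ea wa] := wv _ _ dE Es vs; exists a => //; exact: le_trans wa.
Qed.

(** Interpolation [u << v << s] is what makes this set inaccessible by directed
    suprema: a member above [v] is still way above [u]. *)
Lemma way_above_open u : @open (scott P) [set x | way_below u x].
Proof.
rewrite scott_openE; split; first by move=> a b; exact: way_below_trans_le.
move=> D s dD Ds /way_below_interpolation[v uv vs].
have [a Da va] := vs _ _ dD Ds (lexx s).
by exists a; split=> //; exact: way_below_trans_le va.
Qed.

Lemma continuous_domain_c_space : c_space (scott P).
Proof.
move=> y U; rewrite scott_openE => -[upU lubU] Uy.
have [u [uy Uu]] := lubU _ _ (approx_directed y) (approx_lub y) Uy.
exists u; split.
  rewrite /interior /= nbhsE; exists [set x | way_below u x].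
    by split=> //; exact: way_above_open.
  by move=> z /way_below_le uz; apply/scott_specializationE.
by move=> z /scott_specializationE uz; exact: upU uz.
Qed.

(** The candidate generic point of an irreducible closed [A] is the supremum of
    all elements way below some member of [A].  That set is directed because the
    open sets of points way above [u1] and way above [u2], both meeting [A], meet
    inside [A]. *)
Lemma continuous_domain_sober : sober (scott P).
Proof.
move=> A cA [[a0 Aa0] irrA].
have [lowA lubA] : (forall a b, A b -> (a <= b)%O -> A a) /\
    (forall D s, directed_set D -> D `<=` A -> isLub D s -> A s).
  have := closed_openC cA; rewrite scott_openE => -[upC lubC]; split.
    by move=> a b Ab ab; apply: contrapT => nAa; exact: upC nAa ab Ab.
  move=> D s dD DA Ds; apply: contrapT => nAs.
  by have [a [/DA Aa nAa]] := lubC _ _ dD Ds nAs.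
pose D := [set u : P | exists2 a, A a & way_below u a].
have dD : directed_set D.
  split.
    by have [[u ua] _] := approx_directed a0; exists u, a0.
  move=> u1 u2 [a1 Aa1 ua1] [a2 Aa2 ua2].
  have [a [Aa ua1a ua2a]] : exists a, [/\ A a, way_below u1 a & way_below u2 a].
    apply: contrapT => na.
    have [|Au|Au] := irrA _ _ (open_closedC (way_above_open u1))
      (open_closedC (way_above_open u2)).
    - move=> a Aa; apply/not_andP => -[u1a u2a]; apply: na.
      by exists a.
    - exact: Au Aa1 ua1.
    - exact: Au Aa2 ua2.
  have [u [ua u1u u2u]] := (approx_directed a).2 _ _ ua1a ua2a.
  by exists u; split=> //; exists a.
have [s Ds] := cP.1 _ dD.
have As : A s.
  apply: lubA dD _ Ds => u [a Aa ua].
  exact: lowA Aa (way_below_le ua).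
have AE : A = @closure (scott P) [set s].
  apply/seteqP; split=> [a Aa|a].
    apply/scott_specializationE; apply: (approx_lub a).2 => u ua.
    by apply: Ds.1; exists a.
  by move=> /scott_specializationE; exact: lowA.
exists s; split=> // t At.
by apply: le_anti; apply/andP; split; apply/scott_specializationE;
  rewrite /specialization -?At -?AE //; rewrite ?At; exact: subset_closure.
Qed.

End ContinuousDomain.

Theorem proposition8p5 (X : topologicalType)
    (hlc : locally_compact_space X) (hsober : sober X) :
  [/\ @open (scott (Kset X)) = @open (smyth_power X) :> set (set (Kset X)),
      continuous_domain (Kset X) &
      sober (scott (Kset X)) /\ c_space (scott (Kset X))].
Proof.
have cK := Kset_continuous_domain hlc hsober.
split=> //; first exact: scott_smyth_power_open.
by split; [exact: continuous_domain_sober|exact: continuous_domain_c_space].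
Qed.
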